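(* Let $\mathcal T$ be a good triangulation of $\mathcal C_G$ for an arbitrary multigraph $G=(V,E)$. Let $E_1,D\subseteq E$ be disjoint subsets such that the graph $(V,D)$ contains no cycle (in particular no loops), and for each $f\in D$ choose $p_f\in\{\overleftarrow e_f,\overrightarrow e_f\}$. Then there exists a unique maximal simplex $S\in\mathcal T$ with $\widetilde E(S)=E_1$, $D(S)=D$ and $p_f\in S$ for all $f\in D$. Moreover, every maximal simplex of $\mathcal T$ arises in this way (i.e. for every maximal $S\in\mathcal T$ the graph $(V,D(S))$ is acyclic).
   Context: For a finite undirected multigraph $G=(V,E)$ (loops, parallel edges and isolated nodes allowed) with $n=|V|$, $m=|E|$, work in $\mathbb{R}^V\times\mathbb{R}^E\cong\mathbb{R}^{n+m}$ with standard basis vectors $e_u$ ($u\in V$), $e_f$ ($f\in E$). Fix for each edge $f$ an ordering $(u,v)$ of its endpoints ($u=v$ for a loop) and set $\widetilde e_f=e_u+e_v-e_f$, $\overleftarrow e_f=e_u-e_v+e_f$, $\overrightarrow e_f=-e_u+e_v+e_f$ (so for a loop $\overleftarrow e_f=\overrightarrow e_f=e_f$). The cosmological polytope $\mathcal C_G$ is the convex hull of $\{e_f,\widetilde e_f,\overleftarrow e_f,\overrightarrow e_f: f\in E\}\cup\{e_u: u\in V\}$; these are exactly its lattice points, and it is an $(n+m-1)$-dimensional polytope in the hyperplane $\sum_i x_i=1$. A good triangulation of $\mathcal C_G$ is a regular triangulation (induced by a height function on the lattice points of $\mathcal C_G$) whose vertex set is the set of all lattice points of $\mathcal C_G$ and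 which contains the standard simplex $\mathrm{conv}\{e_u,e_f: u\in V, f\in E\}$ as a maximal cell; simplices are identified with their vertex sets. For a simplex $S\in\mathcal T$: the selected nodes are $V(S)=\{u\in V: e_u\in S\}$; the squiggly edges $\widetilde E(S)=\{f:\widetilde e_f\in S\}$; the selected edges $\widehat E(S)=\{f: e_f\in S\}$; for non-loop edges $f$, $f\in\overleftarrow E(S)$ iff $\overleftarrow e_f\in S$ and $f\in\overrightarrow E(S)$ iff $\overrightarrow e_f\in S$ (loops are never in $\overleftarrow E(S)\cup\overrightarrow E(S)$); the double edges are $D(S)=(\overleftarrow E(S)\cup\overrightarrow E(S))\cap\widehat E(S)$. *)

(* Defs.v *)
From HB Require Import structures.
From mathcomp Require Import all_boot all_order all_algebra.
From mathcomp Require Import reals.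
Set Implicit Arguments. Unset Strict Implicit. Unset Printing Implicit Defensive.
Import Order.TTheory GRing.Theory Num.Theory.
Local Open Scope ring_scope.

Section Cosmo.
Variables (V E : finType) (src tgt : E -> V).

(* Labels of the candidate lattice points of C_G:
   inl u           ~ e_u
   inr (f, 0)      ~ e_f
   inr (f, 1)      ~ tilde e_f
   inr (f, 2)      ~ left-arrow e_f  = e_u - e_v + e_f
   inr (f, 3)      ~ right-arrow e_f = -e_u + e_v + e_f *)
Definition pt := (V + (E * 'I_4))%type.

Definition ordk (k : nat) (H : (k < 4)%N) : 'I_4 := Ordinal H.
Definition nodeP (u : V) : pt := inl u.
Definition edgeP (f : E) : pt := inr (f, @ordk 0 isT).
Definition tildeP (f : E) : pt := inr (f, @ordk 1 isT).
Definition leftP (f : E) : pt := inr (f, @ordk 2 isT).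
Definition rightP (f : E) : pt := inr (f, @ordk 3 isT).

Definition is_loop (f : E) : bool := src f == tgt f.

(* For a loop, left-arrow e_f = right-arrow e_f = e_f, so these labels are
   not separate lattice points: we keep only the label edgeP f. The valid
   labels are in bijection with the lattice points of C_G. *)
Definition valid (p : pt) : bool :=
  match p with
  | inl _ => true
  | inr (f, k) => ((val k <= 1)%N) || ~~ is_loop f
  end.

Variable R : realType.

Definition ind (i j : V + E) : R := (i == j)%:R.

Definition vec (p : pt) (i : V + E) : R :=
  match p with
  | inl u => ind i (inl u)
  | inr (f, k) =>
      match val k with
      | 0 => ind i (inr f)
      | 1 => ind i (inl (src f)) + ind i (inl (tgt f)) - ind i (inr f)
      | 2 => ind i (inl (src f)) - ind i (inl (tgt f)) + ind i (inr f)
      | _ => - ind i (inl (src f)) + ind i (inl (tgt f)) + ind i (inr f)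
      end
  end.

Definition dotp (w : V + E -> R) (p : pt) : R := \sum_(i : V + E) w i * vec p i.

(* Regular subdivision induced by the height function h : the cells are the
   lower faces of the lifted configuration {(p, h p)}; a lower face is the
   set of points where a linear functional w (affine functionals reduce to
   linear ones since all points lie on sum x_i = 1) lying weakly below h
   touches h. Cells are identified with their vertex sets. *)
Definition cell (h : pt -> R) (S : {set pt}) : Prop :=
  exists w : V + E -> R,
    (forall p, valid p -> dotp w p <= h p) /\
    S = [set p | valid p && (dotp w p == h p)].

Definition maximal_cell (h : pt -> R) (S : {set pt}) : Prop :=
  cell h S /\ forall S', cell h S' -> S \subset S' -> S' = S.

(* linear independence of the vectors of S (points lie on sum x = 1, so this
   is affine independence, i.e. S spans a simplex) *)
Definition lin_indep (S : {set pt}) : Prop :=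
  forall c : pt -> R,
    (forall i, \sum_(p in S) c p * vec p i = 0) -> forall p, p \in S -> c p = 0.

Definition std_simplex : {set pt} :=
  [set p | match p with inl _ => true | inr (_, k) => val k == 0%N end].

Definition good_height (h : pt -> R) : Prop :=
  [/\ forall S, cell h S -> lin_indep S,
      forall p, valid p -> exists S, cell h S /\ p \in S
    & maximal_cell h std_simplex].

Definition squiggly (S : {set pt}) : {set E} := [set f | tildeP f \in S].
Definition selected (S : {set pt}) : {set E} := [set f | edgeP f \in S].
Definition leftE (S : {set pt}) : {set E} :=
  [set f | ~~ is_loop f && (leftP f \in S)].
Definition rightE (S : {set pt}) : {set E} :=
  [set f | ~~ is_loop f && (rightP f \in S)].
Definition double_edges (S : {set pt}) : {set E} :=
  (leftE S :|: rightE S) :&: selected S.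

(* the multigraph (V, D) contains a cycle: a closed trail with pairwise
   distinct edges f_0..f_{k-1} in D (k >= 1) and pairwise distinct vertices
   v_0..v_{k-1}, f_i joining v_i and v_{i+1 mod k}. (k = 1: a loop,
   k = 2: two parallel edges.) *)
Definition joins (f : E) (a b : V) : bool :=
  ((src f == a) && (tgt f == b)) || ((src f == b) && (tgt f == a)).

Definition has_cycle (D : {set E}) : Prop :=
  exists (es : seq E) (vs : seq V) (e0 : E) (v0 : V),
    [/\ (0 < size es)%N, size vs = size es, uniq es & uniq vs] /\
    all (fun f => f \in D) es /\
        forall i, (i < size es)%N ->
          joins (nth e0 es i) (nth v0 vs i) (nth v0 vs ((i.+1) %% size es)).

Definition acyclic (D : {set E}) : Prop := ~ has_cycle D.

End Cosmo.
Arguments nodeP {V E}. Arguments edgeP {V E}. Arguments tildeP {V E}.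
Arguments leftP {V E}. Arguments rightP {V E}. Arguments std_simplex {V E}.

(* Main.v *)
Require Import Defs.
From HB Require Import structures.
From mathcomp Require Import all_boot all_order all_algebra.
From mathcomp Require Import reals.
From mathcomp Require Import lra.
Set Implicit Arguments. Unset Strict Implicit. Unset Printing Implicit Defensive.
Import Order.TTheory GRing.Theory Num.Theory.
Local Open Scope ring_scope.

(** Subtracting the functional that supports the standard simplex, we may
    assume that the heights vanish on the e_u and e_f and are positive on all
    other lattice points. A supporting functional is then a point (a, x) with
    a <= 0 on V, and on each edge f = (u, v) the coordinate x_f lies between
    a_u + a_v - h(tilde e_f) and
    min(0, h(left e_f) - a_u + a_v, h(right e_f) + a_u - a_v);
    positivity of the heights makes this interval nondegenerate. At a maximal
    cell every x_f sits at an end of its interval, the lower end exactly for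
    the squiggly edges, and a double edge prescribes a_u - a_v. By linear
    independence the double edges form a forest, and by maximality each of its
    components contains a selected node, where a attains its maximum 0. So a
    is the potential of the forest with the given differences, normalised to
    have maximum 0 on every component, and conversely this potential is always
    feasible. *)

(** * Supporting functionals and the cells they cut out *)

Section LatticePoints.
Variables (V E : finType) (src tgt : E -> V) (R : realType).
Implicit Types (w d : V + E -> R) (p q : pt V E) (h : pt V E -> R).
Implicit Types (S A : {set pt V E}) (f : E) (u v : V).
Local Notation vec := (vec src tgt R).
Local Notation dotp := (dotp src tgt).
Local Notation valid := (valid src tgt).
Local Notation is_loop := (is_loop src tgt).
Local Notation cell := (cell src tgt).
Local Notation maximal_cell := (maximal_cell src tgt).

Lemma sum_ind w (j : V + E) : \sum_i w i * ind R i j = w j.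
Proof.
rewrite (bigD1 j) //= /ind eqxx mulr1 big1 ?addr0 // => i /negbTE->.
by rewrite mulr0.
Qed.

Lemma dotp_node w u : dotp w (nodeP u) = w (inl u).
Proof. exact: sum_ind. Qed.

Lemma dotp_edge w f : dotp w (edgeP f) = w (inr f).
Proof. exact: sum_ind. Qed.

Lemma dotp_tilde w f :
  dotp w (tildeP f) = w (inl (src f)) + w (inl (tgt f)) - w (inr f).
Proof.
rewrite -3!sum_ind -big_split -sumrB.
by apply: eq_bigr => i _; rewrite /= mulrBr mulrDr.
Qed.

Lemma dotp_left w f :
  dotp w (leftP f) = w (inl (src f)) - w (inl (tgt f)) + w (inr f).
Proof.
rewrite -3!sum_ind -sumrB -big_split.
by apply: eq_bigr => i _; rewrite /= mulrDr mulrBr.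
Qed.

Lemma dotp_right w f :
  dotp w (rightP f) = w (inl (tgt f)) - w (inl (src f)) + w (inr f).
Proof.
rewrite -3!sum_ind -sumrB -big_split.
apply: eq_bigr => i _; rewrite /= mulrDr mulrDr mulrN; congr (_ + _).
by rewrite addrC.
Qed.

Definition dotpE := (dotp_node, dotp_edge, dotp_tilde, dotp_left, dotp_right).

Lemma dotp_linear w d t p :
  dotp (fun i => w i + t * d i) p = dotp w p + t * dotp d p.
Proof.
rewrite /dotp mulr_sumr -big_split; apply: eq_bigr => i _ /=.
by rewrite mulrDl mulrA.
Qed.

(** Case analysis by the five kinds of lattice point, hiding the ordinals; the arrow cases carry the
    fact that the edge is no loop. *)
Lemma valid_ind (P : pt V E -> Prop) :
    (forall u, P (nodeP u)) -> (forall f, P (edgeP f)) ->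
    (forall f, P (tildeP f)) -> (forall f, ~~ is_loop f -> P (leftP f)) ->
    (forall f, ~~ is_loop f -> P (rightP f)) ->
  forall p, valid p -> P p.
Proof.
move=> Pn Pe Pt Pl Pr [u _|[f [k ltk]]]; first exact: Pn.
have E4 n (H : (n < 4)%N) : k = n ->
      inr (f, Ordinal ltk) = inr (f, ordk H) :> pt V E.
  by move=> e; congr (inr (_, _)); apply: val_inj.
case: k ltk E4 => [|[|[|[|//]]]] ltk E4 /= nl.
- by rewrite (E4 0%N isT erefl); apply: Pe.
- by rewrite (E4 1%N isT erefl); apply: Pt.
- by rewrite (E4 2%N isT erefl); apply: Pl.
- by rewrite (E4 3%N isT erefl); apply: Pr.
Qed.

Definition feasible h w := forall p, valid p -> dotp w p <= h p.
Definition tight h w : {set pt V E} := [set p | valid p && (dotp w p == h p)].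

Lemma cell_tight h w : feasible h w -> cell h (tight h w).
Proof. by move=> fw; exists w. Qed.

Lemma tightP h w p : p \in tight h w -> dotp w p = h p.
Proof. by rewrite inE => /andP[_ /eqP]. Qed.

Lemma tight_valid h w p : p \in tight h w -> valid p.
Proof. by rewrite inE => /andP[]. Qed.

(** Otherwise [w] could be pushed along [d], keeping its tight points, until a further point becomes
    tight, and the cell would grow. *)
Lemma maximal_cell_ray h w d p :
    feasible h w -> maximal_cell h (tight h w) ->
    (forall q, q \in tight h w -> dotp d q = 0) ->
  valid p -> dotp d p <= 0.
Proof.
move=> fw [_ maxS] dS vp; rewrite leNgt; apply/negP => dp_gt0.
(* [slope q] is the [t] at which [w + t d] touches [h] at [q]; the least one over points with
   [dotp d q > 0] keeps feasibility. *)
pose slope q := (h q - dotp w q) / dotp d q.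
have Pp : valid p && (0 < dotp d p) by rewrite vp.
case: (@arg_minP _ R _ p (fun q => valid q && (0 < dotp d q)) slope Pp).
move=> q /andP[vq dq_gt0] q_min.
have t_ge0 : 0 <= slope q by rewrite divr_ge0 ?(ltW dq_gt0) // subr_ge0 fw.
pose w' i := w i + slope q * d i.
have fw' : feasible h w'.
  move=> r vr; rewrite dotp_linear; have [dr_gt0|dr_le0] := ltP 0 (dotp d r).
    have := q_min r; rewrite vr dr_gt0 => /(_ isT).
    by rewrite [X in _ <= X -> _]/slope ler_pdivlMr // lerBrDl.
  by have := fw r vr; have := mulr_ge0_le0 t_ge0 dr_le0; lra.
have sub : tight h w \subset tight h w'.
  apply/subsetP => r rS; move: (dS r rS) (rS); rewrite !inE dotp_linear => ->.
  by rewrite mulr0 addr0.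
have : q \in tight h w'.
  by rewrite inE vq dotp_linear /slope divfK ?(gt_eqF dq_gt0) // addrC subrK eqxx.
rewrite (maxS _ (cell_tight fw') sub) => /dS dq0.
by rewrite dq0 ltxx in dq_gt0.
Qed.

(** The ray argument for [d] and [-d] makes [d] vanish at every lattice point, in particular on the
    standard basis. *)
Lemma maximal_cell_full h w d :
    feasible h w -> maximal_cell h (tight h w) ->
    (forall q, q \in tight h w -> dotp d q = 0) ->
  d =1 fun=> 0.
Proof.
move=> fw mS dS i.
pose nd j : R := 0 + -1 * d j.
have ndE p : dotp nd p = - dotp d p.
  rewrite dotp_linear mulN1r /dotp big1 ?add0r // => j _.
  by rewrite mul0r.
have ndS q : q \in tight h w -> dotp nd q = 0.
  by move/dS=> dq; rewrite ndE dq oppr0.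
have key p : valid p -> dotp d p = 0.
  move=> vp; apply/eqP; rewrite eq_le (maximal_cell_ray fw mS dS vp).
  by have := maximal_cell_ray fw mS ndS vp; rewrite ndE oppr_le0.
by case: i => [u|f]; [rewrite -dotp_node key | rewrite -dotp_edge key].
Qed.

(** A functional supporting a larger cell differs from [w] by one that vanishes on [tight h w], so
    it equals [w]. *)
Lemma full_maximal_cell h w : feasible h w ->
    (forall d, (forall q, q \in tight h w -> dotp d q = 0) -> d =1 fun=> 0) ->
  maximal_cell h (tight h w).
Proof.
move=> fw full; split=> [|_ [w' [fw' ->]] /subsetP sub]; first exact: cell_tight.
have diff0 : (fun i => w' i + -1 * w i) =1 fun=> 0.
  apply: full => q qS; rewrite dotp_linear (tightP qS) mulN1r.
  by have /tightP -> : q \in tight h w' := sub q qS; rewrite subrr.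
have ww' : w' =1 w.
  by move=> i; apply/eqP; rewrite -subr_eq0 -mulN1r; apply/eqP/diff0.
apply/setP => q; rewrite !inE; congr (_ && (_ == _)).
by apply: eq_bigr => i _; rewrite ww'.
Qed.

Definition translate h w p := h p - dotp w p.

Lemma cell_translate h w S : cell (translate h w) S <-> cell h S.
Proof.
rewrite /translate; split=> [[w' [fw' ->]]|[w' [fw' ->]]].
- exists (fun i => w' i + 1 * w i); split=> [p vp|].
    by rewrite dotp_linear mul1r -lerBrDr fw'.
  by apply/setP => p; rewrite !inE dotp_linear mul1r eq_sym subr_eq eq_sym.
- exists (fun i => w' i + -1 * w i); split=> [p vp|].
    by rewrite dotp_linear mulN1r lerD2r fw'.
  apply/setP => p; rewrite !inE dotp_linear mulN1r.
  by rewrite (inj_eq (addIr (- dotp w p))).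
Qed.

Lemma maximal_cell_translate h w S :
  maximal_cell (translate h w) S <-> maximal_cell h S.
Proof.
have tr S' := cell_translate h w S'.
split=> -[/tr cS maxS]; split=> // S' cS'; apply: maxS; exact/tr.
Qed.

(** * Linear spans of sets of lattice points *)

Definition in_span A (x : V + E -> R) :=
  exists c : pt V E -> R, forall i, x i = \sum_(p in A) c p * vec p i.

Lemma in_span_vec A p : p \in A -> in_span A (vec p).
Proof.
move=> pA; exists (fun q => (q == p)%:R) => i.
rewrite (bigD1 p) //= eqxx mul1r big1 ?addr0 // => q /andP[_ /negbTE->].
by rewrite mul0r.
Qed.

Lemma in_span_linear A t x y z :
  in_span A x -> in_span A y -> (forall i, z i = x i + t * y i) -> in_span A z.
Proof.
move=> [a ax] [b bx] zE; exists (fun p => a p + t * b p) => i.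
rewrite zE ax bx mulr_sumr -big_split; apply: eq_bigr => p _ /=.
by rewrite mulrDl mulrA.
Qed.

Lemma lin_indep_span S q :
  lin_indep src tgt R S -> q \in S -> ~ in_span (S :\ q) (vec q).
Proof.
move=> indS qS [c cq].
have := indS (fun p => if p == q then -1 else c p) _ q qS.
rewrite eqxx => H; suff /eqP : (-1 : R) = 0 by rewrite oppr_eq0 oner_eq0.
apply: H => i; rewrite (big_setD1 q) //= eqxx mulN1r cq addrC.
apply/eqP; rewrite subr_eq0; apply/eqP; apply: eq_bigr => p.
by rewrite !inE => /andP[/negbTE->].
Qed.

End LatticePoints.

(** * Cycles, connectivity and potentials on forests *)

Section Forests.
Variables (V E : finType) (src tgt : E -> V).
Implicit Types (D : {set E}) (f : E) (u v : V).
Local Notation joins := (joins src tgt).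
Local Notation has_cycle := (has_cycle src tgt).
Local Notation acyclic := (acyclic src tgt).

Definition adj D : rel V := fun u v => [exists f in D, joins f u v].

Lemma joinsC f u v : joins f u v = joins f v u.
Proof. by rewrite /Defs.joins orbC. Qed.

Lemma joins_ends f : joins f (src f) (tgt f).
Proof. by rewrite /Defs.joins !eqxx. Qed.

Lemma adj_edge D f : f \in D -> adj D (src f) (tgt f).
Proof. by move=> fD; apply/existsP; exists f; rewrite fD joins_ends. Qed.

Lemma connect_adj_sym D : connect_sym (adj D).
Proof.
apply: sym_connect_sym => u v.
by apply: eq_existsb => f; rewrite joinsC.
Qed.

Lemma connect_adj_const (T : Type) (a : V -> T) D u v :
    (forall f, f \in D -> a (src f) = a (tgt f)) ->
  connect (adj D) u v -> a u = a v.
Proof.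
move=> aD /connectP[s]; elim: s u => [|x s IHs] u /=; first by move=> _ ->.
case/andP=> /existsP[f /andP[fD /orP[]/andP[/eqP<- /eqP xE]]] px /(IHs _ px).
  by rewrite -xE (aD f fD).
by rewrite -xE (aD f fD).
Qed.

Lemma has_cycle_connect D f :
  f \notin D -> connect (adj D) (src f) (tgt f) -> has_cycle (f |: D).
Proof.
move=> fND /connectP[s0 path0]; case/shortenP: path0 => s path_s uniq_s _ vE.
set u := src f in path_s uniq_s vE.
pose g a b := odflt f [pick e in D | joins e a b].
have gP a b : adj D a b -> (g a b \in D) && joins (g a b) a b.
  by move/existsP=> [e eP]; rewrite /g; case: pickP => // /(_ e); rewrite eP.
pose es := rcons (pairmap g u s) f.
have es_nth i : (i < size s)%N ->
    (nth f es i \in D) && joins (nth f es i) (nth u (u :: s) i) (nth u s i).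
  move=> lti; rewrite nth_rcons size_pairmap lti (nth_pairmap u) //.
  exact: gP ((pathP u path_s) i lti).
have sz : size es = (size s).+1 by rewrite size_rcons size_pairmap.
exists es, (u :: s), f, u; split; [split=> //; first by rewrite sz|split].
- rewrite rcons_uniq; apply/andP; split.
    apply/negP => /(nthP f)[i]; rewrite size_pairmap => lti gi.
    have := es_nth i lti; rewrite nth_rcons size_pairmap lti gi.
    by rewrite (negPf fND).
  apply/(uniqP f) => i j; rewrite !inE size_pairmap => lti ltj gij.
  have /andP[_ ji] := es_nth i lti; have /andP[_ jj] := es_nth j ltj.
  move: ji jj; rewrite !nth_rcons size_pairmap lti ltj gij.
  have ltiS : (i < (size s).+1)%N by rewrite ltnS ltnW.
  have ltjS : (j < (size s).+1)%N by rewrite ltnS ltnW.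
  have nthS k : nth u s k = nth u (u :: s) k.+1 by [].
  rewrite !nthS /Defs.joins.
  (* Equal edges have equal end pairs. Matched in the same order they give [i = j]; crossed,
     [i = j + 1] and [i + 1 = j], which is absurd. *)
  case/orP=> /andP[/eqP-> /eqP->];
    rewrite !nth_uniq //=; case/orP=> /andP[/eqP e1 /eqP e2] //.
  - by move/eqP: e2; rewrite e1 gtn_eqF.
  - by move/eqP: e2; rewrite -e1 ltn_eqF.
- apply/allP => e /(nthP f)[i]; rewrite sz ltnS leq_eqVlt => /orP[/eqP->|lti].
    by rewrite nth_rcons size_pairmap ltnn eqxx => <-; rewrite setU11.
  by move=> <-; rewrite inE; have /andP[-> _] := es_nth i lti; rewrite orbT.
- move=> i; rewrite sz ltnS leq_eqVlt => /orP[/eqP->|lti].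
    rewrite modnn nth_rcons size_pairmap ltnn eqxx -last_nth -vE joinsC.
    exact: joins_ends.
  by rewrite modn_small ?ltnS //; have /andP[_] := es_nth i lti.
Qed.

(** The first edge of the cycle serves as [f]: the remaining edges lead from its second vertex round
    to its first. *)
Lemma has_cycle_bridge D : has_cycle D ->
  exists f u v, [/\ f \in D, joins f u v & connect (adj (D :\ f)) u v].
Proof.
case=> es [vs] [e0] [v0] [[k_gt0 szvs ues _] [/allP esD es_joins]].
set k := size es in k_gt0 es_joins.
have inD i : (i < k)%N -> nth e0 es i \in D by move=> lti; apply/esD/mem_nth.
(* The index [1 %% k] is 0 for a loop, where the remaining path is empty. *)
exists (nth e0 es 0), (nth v0 vs (1 %% k)), (nth v0 vs 0).
split; [exact: inD | by rewrite joinsC es_joins |].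
suff key j : (j < k)%N ->
    connect (adj (D :\ nth e0 es 0)) (nth v0 vs (1 %% k))
      (nth v0 vs (j.+1 %% k)).
  by have := key k.-1; rewrite prednK // modnn leqnn; apply.
elim: j => [|j IHj] ltj; first exact: connect0.
apply: connect_trans (IHj (ltnW ltj)) (connect1 _).
apply/existsP; exists (nth e0 es j.+1).
by rewrite modn_small // es_joins // andbT !inE inD // nth_uniq.
Qed.

Lemma acyclicS D D' : D' \subset D -> acyclic D -> acyclic D'.
Proof.
move=> /subsetP sub acD [es [vs [e0 [v0 [H [/allP allD' J]]]]]]; apply: acD.
exists es, vs, e0, v0; split=> //; split=> //.
by apply/allP => e /allD' /sub.
Qed.

Lemma acyclic_loopfree D f : acyclic D -> f \in D -> ~~ is_loop src tgt f.
Proof.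
move=> acD fD; apply/negP => /eqP lf; apply: acD.
rewrite -(setD1K fD); apply: has_cycle_connect; first by rewrite setD11.
by rewrite lf connect0.
Qed.

(** Induction on the number of edges: removing [f] separates its ends, so shifting the potential on
    the component of [src f] corrects the difference at [f] and preserves all others. *)
Lemma acyclic_potential (R : zmodType) (c : E -> R) D : acyclic D ->
  exists a : V -> R, forall f, f \in D -> a (src f) - a (tgt f) = c f.
Proof.
move: {2}#|D| (erefl #|D|) => n; elim: n D => [|n IHn] D cardD acD.
  by exists (fun=> 0) => f; rewrite (cards0_eq cardD) inE.
have /card_gt0P[f fD] : (0 < #|D|)%N by rewrite cardD.
have [||a aP] := IHn (D :\ f).
- by move: cardD; rewrite (cardsD1 f) fD => -[].
- exact: acyclicS (subsetDl _ _) acD.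
have nconn : ~~ connect (adj (D :\ f)) (src f) (tgt f).
  apply/negP => conn; apply: acD; rewrite -(setD1K fD).
  by apply: has_cycle_connect conn; rewrite setD11.
pose shift u := connect (adj (D :\ f)) (src f) u.
exists (fun u => if shift u then a u + (c f - a (src f) + a (tgt f)) else a u).
move=> g gD; have [->|gf] := eqVneq g f.
  by rewrite /shift connect0 (negPf nconn) addrA addrK addrC subrK.
have gD' : g \in D :\ f by rewrite !inE gf.
have -> : shift (src g) = shift (tgt g).
  apply: (same_connect_r (@connect_adj_sym _)); apply: connect1.
  exact: adj_edge.
case: ifP => _; last exact: aP.
by rewrite opprD addrACA subrr addr0 aP.
Qed.

Lemma acyclic_max_potential (R : realDomainType) (c : E -> R) D : acyclic D ->
  exists a : V -> R,
    [/\ forall f, f \in D -> a (src f) - a (tgt f) = c f,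
        forall u, a u <= 0
      & forall u, exists2 r, connect (adj D) u r & a r = 0].
Proof.
move=> /(@acyclic_potential R c)[a aP].
have symD := @connect_adj_sym D.
pose top u := [arg max_(v > u | connect (adj D) u v) a v]%O.
(* Taking the maximum from the canonical root makes [m] constant on components by construction. *)
pose m u := a (top (fingraph.root (adj D) u)).
have topP u : connect (adj D) u (top u) /\
    forall v, connect (adj D) u v -> a v <= a (top u).
  by rewrite /top; case: arg_maxP => // v uv vmax; split.
have mE u v : connect (adj D) u v -> m u = m v.
  by rewrite -(root_connect symD) /m => /eqP->.
exists (fun u => a u - m u); split=> [f fD|u|u].
- rewrite (mE (src f) (tgt f)); last by apply/connect1/adj_edge.
  by rewrite opprD opprK addrACA addNr addr0 aP.
- rewrite subr_le0; apply: (topP _).2.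
  by rewrite symD connect_root.
- have ur : connect (adj D) u (top (fingraph.root (adj D) u)).
    exact: connect_trans (connect_root _ _) (topP _).1.
  by exists (top (fingraph.root (adj D) u)) => //; rewrite -(mE _ _ ur) subrr.
Qed.

End Forests.

(** * Double edges and linear independence *)

Section Normalized.
Variables (V E : finType) (src tgt : E -> V) (R : realType) (h : pt V E -> R).
Implicit Types (w d : V + E -> R) (p q : pt V E) (D : {set E}).
Implicit Types (S A : {set pt V E}) (f : E) (u v : V).
Local Notation vec := (vec src tgt R).
Local Notation dotp := (dotp src tgt).
Local Notation valid := (valid src tgt).
Local Notation is_loop := (is_loop src tgt).
Local Notation joins := (joins src tgt).
Local Notation adj := (adj src tgt).
Local Notation acyclic := (acyclic src tgt).
Local Notation double_edges := (double_edges src tgt).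
Local Notation feasible := (feasible src tgt h).
Local Notation tight := (tight src tgt h).
Local Notation maximal_cell := (maximal_cell src tgt h).

Definition node_diff u v (i : V + E) : R := ind R i (inl u) - ind R i (inl v).

Lemma double_edgesP S f : reflect
  [/\ ~~ is_loop f, edgeP f \in S & (leftP f \in S) || (rightP f \in S)]
  (f \in double_edges S).
Proof.
rewrite !inE -andb_orr.
by apply: (iffP andP) => [[/andP[-> ->] ->]|[-> -> ->]].
Qed.

(** The sign [s] covers both arrows and both orders of the ends; [s * s = 1] allows solving for
    [node_diff u v]. *)
Lemma arrow_vec f u v q : joins f u v -> q = leftP f \/ q = rightP f ->
  exists2 s : R, s * s = 1 &
    forall i, vec q i = vec (edgeP f) i + s * node_diff u v i.
Proof.
by case/orP=> /andP[/eqP<- /eqP<-] [->|->];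
  (exists 1 + exists (-1)); rewrite ?mulrNN ?mulr1 // => i;
  rewrite /node_diff /=; lra.
Qed.

(** Removing an arrow of another edge leaves [edgeP f] and an arrow of [f] in place, and these
    differ by plus or minus [node_diff u v]. *)
Lemma double_edge_span S f q g u v : f \in double_edges S -> f != g ->
  q = leftP g \/ q = rightP g -> joins f u v ->
  in_span src tgt (S :\ q) (node_diff u v).
Proof.
move=> /double_edgesP[_ eS arrow] fg qE Juv.
have ne k k' : inr (f, k) != inr (g, k') :> pt V E.
  by apply/negP => /eqP[e _]; rewrite e eqxx in fg.
have inA k : inr (f, k) \in S -> inr (f, k) \in S :\ q.
  by move=> kS; rewrite inE kS andbT inE; case: qE => ->; apply: ne.
have [p pA pE] : exists2 p, p \in S :\ q & p = leftP f \/ p = rightP f.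
  case/orP: arrow => pS; [exists (leftP f)|exists (rightP f)];
    by [apply: inA | left | right].
have [s ss pV] := arrow_vec Juv pE.
have zeroA : in_span src tgt (S :\ q) (fun=> 0 : R).
  by exists (fun=> 0) => i; rewrite big1 // => r _; rewrite mul0r.
have subA := in_span_linear (t := -1) (in_span_vec src tgt R pA)
  (in_span_vec src tgt R (inA _ eS)) (fun i => erefl).
apply: (in_span_linear (t := s) zeroA subA) => i.
by rewrite pV mulN1r add0r addrAC subrr add0r mulrA ss mul1r.
Qed.

Lemma connect_span A D u v :
    (forall f x y, f \in D -> joins f x y ->
       in_span src tgt A (node_diff x y)) ->
  connect (adj D) u v -> in_span src tgt A (node_diff u v).
Proof.
move=> spanD /connectP[s]; elim: s u => [|x s IHs] u /=.
  move=> _ ->; exists (fun=> 0) => i; rewrite big1 => [|p _]; last exact: mul0r.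
  by rewrite /node_diff subrr.
case/andP=> /existsP[f /andP[fD Jux]] px /(IHs _ px) span_xv.
apply: (in_span_linear (t := 1) (spanD f u x fD Jux) span_xv) => i.
by rewrite /node_diff mul1r addrA subrK.
Qed.

(** Here [q] is an arrow of [f] in [S]. Since [edgeP f] stays in [S :\ q], spanning [node_diff u v]
    would mean spanning [q] itself. *)
Lemma double_edge_indep S f : lin_indep src tgt R S -> f \in double_edges S ->
  exists q, (q = leftP f \/ q = rightP f) /\
    forall u v, joins f u v -> ~ in_span src tgt (S :\ q) (node_diff u v).
Proof.
move=> indS /double_edgesP[_ eS arrow].
have [q qS qE] : exists2 q, q \in S & q = leftP f \/ q = rightP f.
  by case/orP: arrow; [exists (leftP f) | exists (rightP f)]; auto.
exists q; split=> // u v Juv span_uv; apply: (lin_indep_span indS qS).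
have [s _ qV] := arrow_vec Juv qE.
apply: in_span_linear (in_span_vec src tgt R _) span_uv qV.
by rewrite inE eS andbT inE; case: qE => ->; apply/negP => /eqP[].
Qed.

(** On a cycle, the other double edges telescope to the node difference of the chosen edge. *)
Lemma lin_indep_acyclic S : lin_indep src tgt R S -> acyclic (double_edges S).
Proof.
move=> indS /has_cycle_bridge[f [u [v [fD Juv conn]]]].
have [q [qE]] := double_edge_indep indS fD; apply; first exact: Juv.
apply: connect_span conn => g x y /setD1P[gf gD] Jxy.
exact: double_edge_span gD gf qE Jxy.
Qed.

(** The selected nodes and the edges of [D] already span every [e_u], so one more double edge would
    create a dependence. *)
Lemma lin_indep_double_edges S D : lin_indep src tgt R S ->
    D \subset double_edges S ->
    (forall u, exists2 r, connect (adj D) u r & nodeP r \in S) ->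
  double_edges S = D.
Proof.
move=> indS subD rootD; apply/eqP; rewrite eqEsubset subD andbT.
apply/subsetP => f fDS; apply: contraT => fND.
have [q [qE qN]] := double_edge_indep indS fDS.
case: (qN _ _ (joins_ends src tgt f)).
have node_span u : in_span src tgt (S :\ q) (vec (nodeP u)).
  have [r conn rS] := rootD u.
  have span_ur : in_span src tgt (S :\ q) (node_diff u r).
    apply: connect_span conn => g x y gD Jxy.
    apply: double_edge_span (subsetP subD g gD) _ qE Jxy.
    by apply: contraNneq fND => <-.
  apply: (in_span_linear (t := 1) span_ur (in_span_vec src tgt R (p := nodeP r) _)).
    by rewrite inE rS andbT inE; case: qE => ->; apply/negP => /eqP.
  by move=> i; rewrite /node_diff /= mul1r subrK.
apply: (in_span_linear (t := -1) (node_span _) (node_span _)) => i.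
by rewrite /node_diff /= mulN1r.
Qed.

(** * Heights vanishing on the standard simplex and positive elsewhere *)

Hypotheses (h_node : forall u, h (nodeP u) = 0)
  (h_edge : forall f, h (edgeP f) = 0)
  (h_tilde : forall f, 0 < h (tildeP f))
  (h_left : forall f, ~~ is_loop f -> 0 < h (leftP f))
  (h_right : forall f, ~~ is_loop f -> 0 < h (rightP f)).

Lemma feasible_node w u : feasible w -> w (inl u) <= 0.
Proof. by move/(_ (nodeP u) isT); rewrite dotpE h_node. Qed.

Lemma feasible_edge w f : feasible w -> w (inr f) <= 0.
Proof. by move/(_ (edgeP f) isT); rewrite dotpE h_edge. Qed.

Lemma node_tight w u : (nodeP u \in tight w) = (w (inl u) == 0).
Proof. by rewrite inE dotpE h_node. Qed.

Lemma edge_tight w f : (edgeP f \in tight w) = (w (inr f) == 0).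
Proof. by rewrite inE dotpE h_edge. Qed.

Lemma left_tight w f : leftP f \in tight w -> ~~ is_loop f.
Proof. exact: tight_valid. Qed.

Lemma right_tight w f : rightP f \in tight w -> ~~ is_loop f.
Proof. exact: tight_valid. Qed.

(** As [w] is nonpositive on nodes and [h (tildeP f) > 0], the lower bound for [w (inr f)] lies
    strictly below all upper bounds. *)
Lemma tilde_tight_excl w f : feasible w -> tildeP f \in tight w ->
  [/\ edgeP f \notin tight w, leftP f \notin tight w
    & rightP f \notin tight w].
Proof.
move=> fw /tightP; rewrite dotpE => tE.
have := feasible_node (src f) fw; have := feasible_node (tgt f) fw.
have tpos := h_tilde f => le_t le_s; split; apply/negP.
- by rewrite edge_tight => /eqP; lra.
- by move=> lS; have := h_left (left_tight lS);
  move/tightP: lS; rewrite dotpE; lra.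
- by move=> rS; have := h_right (right_tight rS);
  move/tightP: rS; rewrite dotpE; lra.
Qed.

(** Adding the two equalities would give [2 w (inr f) > 0]. *)
Lemma left_right_excl w f : feasible w -> leftP f \in tight w ->
  rightP f \notin tight w.
Proof.
move=> fw lS; apply/negP => rS.
have := feasible_edge f fw; have := h_left (left_tight lS).
have := h_right (left_tight lS).
by move/tightP: lS; move/tightP: rS; rewrite !dotpE; lra.
Qed.

(* If the component of u had no selected node, its indicator function would
   extend to a nonzero functional vanishing on the cell. *)
Lemma maximal_cell_root w u : feasible w -> maximal_cell (tight w) ->
  exists2 r, connect (adj (double_edges (tight w))) u r & nodeP r \in tight w.
Proof.
move=> fw mS; set S := tight w; set D := double_edges S.
case: (boolP [exists r, connect (adj D) u r && (nodeP r \in S)]).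
  by case/existsP=> r /andP[]; exists r.
rewrite negb_exists => /forallP noroot.
pose a v : R := (connect (adj D) u v)%:R.
have aD f : f \in D -> a (src f) = a (tgt f).
  move=> fD; rewrite /a; congr ((_ : bool)%:R).
  apply: (same_connect_r (@connect_adj_sym _ _ _ _ _)).
  exact/connect1/adj_edge.
(* At most one of the squiggly point and the arrows of [f] is tight, and the edge value is chosen to
   make [d] vanish there. If [edgeP f] is also tight, [f] is double and [aD] makes that value 0. *)
pose d (i : V + E) : R := match i with
  | inl v => a v
  | inr f => if tildeP f \in S then a (src f) + a (tgt f)
             else if leftP f \in S then a (tgt f) - a (src f)
             else if rightP f \in S then a (src f) - a (tgt f) else 0
  end.
suff /(_ (inl u))/eqP : d =1 fun=> 0 by rewrite /d /a connect0 oner_eq0.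
apply: (maximal_cell_full fw mS) => q qS; have vq := tight_valid qS.
have excl f := @tilde_tight_excl w f fw.
elim/valid_ind: q / vq qS => [v|f|f|f nl|f nl] qS; rewrite dotpE /d.
- by rewrite /a; have := noroot v; rewrite qS andbT => /negbTE->.
- case: ifP => [/excl[]|_]; first by rewrite qS.
  have inD : (leftP f \in S) || (rightP f \in S) -> a (src f) = a (tgt f).
    move=> arrow; apply: aD; apply/double_edgesP; split=> //.
    by case/orP: arrow => [/left_tight|/right_tight].
  case: ifP inD => [_ ->|_]; rewrite ?orbT ?subrr //.
  by case: ifP => [_ ->|//]; rewrite ?subrr.
- by rewrite qS subrr.
- case: ifP => [/excl[]|_]; first by rewrite qS.
  by rewrite qS; lra.
- case: ifP => [/excl[]|_]; first by rewrite qS.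
  case: ifP => [/(left_right_excl fw)|_]; first by rewrite qS.
  by rewrite qS; lra.
Qed.

(** Otherwise no tight point involves the coordinate [inr f], and the corresponding unit functional
    vanishes on the cell. *)
Lemma maximal_cell_edge w f : feasible w -> maximal_cell (tight w) ->
  tildeP f \notin tight w ->
  [|| edgeP f \in tight w, leftP f \in tight w | rightP f \in tight w].
Proof.
move=> fw mS tN; apply: contraT; rewrite !negb_or => /and3P[eN lN rN].
pose d (i : V + E) : R := (i == inr f)%:R.
suff /(_ (inr f))/eqP : d =1 fun=> 0 by rewrite /d eqxx oner_eq0.
apply: (maximal_cell_full fw mS) => q qS; have vq := tight_valid qS.
elim/valid_ind: q / vq qS => [v|g|g|g nl|g nl] qS; rewrite dotpE /d //=.
all: rewrite ?addr0 ?subr0 ?add0r (inj_eq (@inr_inj _ _)).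
all: by case: eqP qS tN eN lN rN => [->|_] qS; rewrite ?qS ?oppr0.
Qed.

Lemma min3_cases (x y z : R) (m := Num.min x (Num.min y z)) :
  [/\ m <= x, m <= y, m <= z & [\/ m = x, m = y | m = z]].
Proof.
rewrite /m; case: (leP y z) => yz; [case: (leP x y) | case: (leP x z)] => ?;
  by split; first [lra | constructor].
Qed.

(** * Uniqueness and existence of the cell with prescribed data *)

Section Prescribed.
Variables (E1 D : {set E}) (p : E -> bool).
Let arrowP f : pt V E := if p f then leftP f else rightP f.

Definition prescribed S := [/\ maximal_cell S, squiggly S = E1,
  double_edges S = D & forall f, f \in D -> arrowP f \in S].

Lemma prescribed_diff w f : prescribed (tight w) -> f \in D ->
  w (inl (src f)) - w (inl (tgt f)) =
    if p f then h (leftP f) else - h (rightP f).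
Proof.
move=> [_ _ DE arrow] fD; have := arrow f fD.
have /double_edgesP[_ + _] : f \in double_edges (tight w) by rewrite DE.
rewrite edge_tight => /eqP xf; rewrite /arrowP.
by case: (p f) => /tightP; rewrite dotpE xf; lra.
Qed.

(** The difference [w1 - w2] is constant on components of [D], and at a node selected by [w2] it
    equals [w1], hence is nonpositive. *)
Lemma prescribed_node_le w1 w2 u : feasible w1 -> feasible w2 ->
  prescribed (tight w1) -> prescribed (tight w2) -> w1 (inl u) <= w2 (inl u).
Proof.
move=> fw1 fw2 P1 P2; have [mS _ DE _] := P2.
have [r conn] := maximal_cell_root u fw2 mS; rewrite node_tight => /eqP r0.
rewrite -subr_le0; pose b v := w1 (inl v) - w2 (inl v).
have -> : w1 (inl u) - w2 (inl u) = b r.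
  apply: (connect_adj_const (a := b)) conn => f; rewrite DE => fD.
  have := prescribed_diff P1 fD; rewrite -(prescribed_diff P2 fD) /b; lra.
by rewrite /b r0 subr0 feasible_node.
Qed.

(** On a squiggly edge both values are the same lower bound; elsewhere [w2] attains an upper bound
    that [w1] obeys too. *)
Lemma prescribed_edge_le w1 w2 f : feasible w1 -> feasible w2 ->
    (forall u, w1 (inl u) = w2 (inl u)) ->
  prescribed (tight w1) -> prescribed (tight w2) -> w1 (inr f) <= w2 (inr f).
Proof.
move=> fw1 fw2 node_eq [_ sq1 _ _] [mS2 sq2 _ _].
have tE w : (f \in squiggly (tight w)) = (tildeP f \in tight w) by rewrite inE.
case: (boolP (tildeP f \in tight w2)) => [t2|tN2].
  have : tildeP f \in tight w1 by rewrite -tE sq1 -sq2 tE.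
  by move/tightP: t2; move=> + /tightP; rewrite !dotpE !node_eq; lra.
have := maximal_cell_edge fw2 mS2 tN2.
case/or3P=> qS; have vq := tight_valid qS.
all: by have := fw1 _ vq; move/tightP: qS => <-; rewrite !dotpE ?node_eq; lra.
Qed.

Lemma prescribed_unique w1 w2 : feasible w1 -> feasible w2 ->
  prescribed (tight w1) -> prescribed (tight w2) -> tight w1 = tight w2.
Proof.
move=> fw1 fw2 P1 P2.
have node_eq u : w1 (inl u) = w2 (inl u).
  by apply/eqP; rewrite eq_le !prescribed_node_le.
have w12 : w1 =1 w2.
  move=> [u|f]; first exact: node_eq.
  by apply/eqP; rewrite eq_le !prescribed_edge_le.
apply/setP => q; rewrite !inE; congr (_ && (_ == _)).
by apply: eq_bigr => i _; rewrite w12.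
Qed.

Hypothesis h_indep : forall w, feasible w -> lin_indep src tgt R (tight w).

Lemma prescribed_exists : [disjoint E1 & D] -> acyclic D ->
  exists2 w, feasible w & prescribed (tight w).
Proof.
move=> disj acD.
pose c f := if p f then h (leftP f) else - h (rightP f).
have [a [a_diff a_le0 a_root]] := acyclic_max_potential c acD.
(* The lower end of the interval on [E1], the upper end elsewhere; a loop has no arrows, so its
   upper end is 0. *)
pose x f := if f \in E1 then a (src f) + a (tgt f) - h (tildeP f)
  else if is_loop f then 0
  else Num.min 0 (Num.min (h (leftP f) - a (src f) + a (tgt f))
                          (h (rightP f) + a (src f) - a (tgt f))).
pose w (i : V + E) := match i with inl u => a u | inr f => x f end.
have x_loop f : f \notin E1 -> is_loop f -> x f = 0.
  by rewrite /x => /negbTE-> ->.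
have x_arrow f : f \notin E1 -> ~~ is_loop f ->
    [/\ x f <= 0, x f <= h (leftP f) - a (src f) + a (tgt f),
        x f <= h (rightP f) + a (src f) - a (tgt f)
      & [\/ x f = 0, x f = h (leftP f) - a (src f) + a (tgt f)
         | x f = h (rightP f) + a (src f) - a (tgt f)]].
  by rewrite /x => /negbTE-> /negbTE->; apply: min3_cases.
have xP f : [/\ x f <= 0, a (src f) + a (tgt f) - x f <= h (tildeP f),
    (a (src f) + a (tgt f) - x f == h (tildeP f)) = (f \in E1),
    ~~ is_loop f -> x f <= h (leftP f) - a (src f) + a (tgt f) &
    ~~ is_loop f -> x f <= h (rightP f) + a (src f) - a (tgt f)].
  have := h_tilde f; have := a_le0 (src f); have := a_le0 (tgt f).
  have := @h_left f; have := @h_right f => hr hl ht hs tpos.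
  have [fE1|fN1] := boolP (f \in E1).
    have xE : x f = a (src f) + a (tgt f) - h (tildeP f) by rewrite /x fE1.
    split; [lra | lra | apply/eqP; lra | move=> nl | move=> nl].
      by have := hl nl; lra.
    by have := hr nl; lra.
  have [lf|nl] := boolP (is_loop f).
    by rewrite x_loop //; split=> //; [lra | apply/negP => /eqP; lra].
  have [x0 xl xr xE] := x_arrow f fN1 nl; have := hl nl; have := hr nl.
  by split=> //; [| apply/negP => /eqP]; case: xE; lra.
have fw : feasible w.
  apply: valid_ind => [u|f|f|f nl|f nl]; rewrite dotpE ?h_node ?h_edge //=.
  - by have [] := xP f.
  - by have [] := xP f.
  - by have [_ _ _ /(_ nl) + _] := xP f; lra.
  - by have [_ _ _ _ /(_ nl)] := xP f; lra.
have xT f : f \notin E1 ->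
    [|| edgeP f \in tight w, leftP f \in tight w | rightP f \in tight w].
  move=> fN1; rewrite !inE !dotpE /= h_edge.
  have [lf|nl] /= := boolP (is_loop f); first by rewrite x_loop ?eqxx.
  have [_ _ _ xE] := x_arrow f fN1 nl; apply/or3P.
  by case: xE => xE; [apply: Or31|apply: Or32|apply: Or33]; apply/eqP; lra.
have xD f : f \in D -> (edgeP f \in tight w) && (arrowP f \in tight w).
  move=> fD; have nl := acyclic_loopfree acD fD.
  (* The potential makes the bound from the chosen arrow 0 and the opposite one
     [h (leftP f) + h (rightP f) > 0], so the minimum is 0. *)
  have x0 : x f = 0.
    have fN1 : f \notin E1 by apply: contraTN fD => /(disjointFr disj)->.
    have := a_diff f fD; rewrite /c; have := h_left nl; have := h_right nl.
    have [_ xl xr xE] := x_arrow f fN1 nl.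
    by case: (p f); case: xE; lra.
  rewrite edge_tight /= x0 eqxx /= /arrowP inE.
  have := a_diff f fD; rewrite /c; case: (p f) => e;
    by rewrite dotpE /= nl x0; apply/eqP; lra.
have subD : D \subset double_edges (tight w).
  apply/subsetP => f fD; have /andP[eS aS] := xD f fD.
  apply/double_edgesP; split=> //; first exact: acyclic_loopfree acD fD.
  by move: aS; rewrite /arrowP; case: (p f) => ->; rewrite ?orbT.
have rootD u : exists2 r, connect (adj D) u r & nodeP r \in tight w.
  by have [r conn r0] := a_root u; exists r; rewrite // node_tight /= r0.
(* Independence of cells excludes accidental double edges outside [D]. *)
have DE := lin_indep_double_edges (h_indep fw) subD rootD.
have sqE : squiggly (tight w) = E1.
  by apply/setP => f; rewrite !inE dotpE /=; have [_ _ -> _ _] := xP f.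
exists w => //; split=> //; last by move=> f /xD/andP[].
(* A functional vanishing on the cell is constant on components of [D] and 0 at their roots; one
   tight point per edge then fixes its edge values. *)
apply: full_maximal_cell => // d dS.
have d_node u : d (inl u) = 0.
  have [r conn /dS] := rootD u; rewrite dotpE => <-.
  apply: (connect_adj_const (a := fun v => d (inl v))) conn => f fD.
  have /andP[/dS + /dS] := xD f fD; rewrite /arrowP.
  by case: (p f); rewrite !dotpE; lra.
have d_edge q f : q \in tight w ->
    [\/ q = edgeP f, q = tildeP f, q = leftP f | q = rightP f] -> d (inr f) = 0.
  by move=> /dS + qE; case: qE => ->; rewrite dotpE ?d_node; lra.
move=> [u|f]; first exact: d_node.
case: (boolP (f \in E1)) => [|fN1].
  by rewrite -sqE inE => /d_edge; apply; constructor.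
by have := xT f fN1; case/or3P=> /d_edge; apply; constructor.
Qed.

End Prescribed.
End Normalized.

(* p f = true means p_f = left-arrow e_f, false means right-arrow e_f. *)
Theorem mainTheorem6 (V E : finType) (src tgt : E -> V) (R : realType)
    (h : pt V E -> R) :
  good_height src tgt h ->
  (forall (E1 D : {set E}) (p : E -> bool),
      [disjoint E1 & D] -> acyclic src tgt D ->
      exists! S : {set pt V E},
        [/\ maximal_cell src tgt h S,
            squiggly S = E1,
            double_edges src tgt S = D &
            forall f, f \in D -> (if p f then leftP f else rightP f) \in S])
  /\ (forall S : {set pt V E}, maximal_cell src tgt h S ->
        acyclic src tgt (double_edges src tgt S)).
Proof.
move=> [cell_indep _ [[w0 [fw0 stdE]] _]].
split=> [E1 D p disj acD|S [/cell_indep/lin_indep_acyclic]//].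
(* Translation by the functional supporting the standard simplex normalises the heights and keeps
   all cells. *)
pose h' := translate src tgt h w0.
have h'0 q : q \in std_simplex -> h' q = 0.
  by rewrite stdE inE => /andP[_ /eqP e]; rewrite /h' /translate e subrr.
have h'_gt0 q : valid src tgt q -> q \notin std_simplex -> 0 < h' q.
  move=> vq; rewrite stdE inE vq /= => ne.
  by rewrite /h' /translate subr_gt0 lt_neqAle ne fw0.
have h'_node u : h' (nodeP u) = 0 by apply: h'0; rewrite inE.
have h'_edge f : h' (edgeP f) = 0 by apply: h'0; rewrite inE.
have h'_tilde f : 0 < h' (tildeP f) by apply: h'_gt0; rewrite ?inE.
have h'_left f : ~~ is_loop src tgt f -> 0 < h' (leftP f).
  by move=> nl; apply: h'_gt0; rewrite ?inE.
have h'_right f : ~~ is_loop src tgt f -> 0 < h' (rightP f).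
  by move=> nl; apply: h'_gt0; rewrite ?inE.
have h'_indep w : feasible src tgt h' w ->
    lin_indep src tgt R (tight src tgt h' w).
  by move=> /cell_tight/cell_translate/cell_indep.
have [w fw Pw] := prescribed_exists h'_node h'_edge h'_tilde h'_left h'_right
  p h'_indep disj acD.
exists (tight src tgt h' w); split.
  by case: (Pw) => /maximal_cell_translate.
move=> S [/(maximal_cell_translate _ _ h w0) mS sqS DS arrowS].
have [[w' [fw' SE]] _] := mS; rewrite SE.
apply: (prescribed_unique h'_node h'_edge h'_tilde h'_left h'_right fw fw' Pw).
by rewrite /prescribed /tight -SE.
Qed.
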